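(* Let $p$ be a prime and let $R$ be a non-commutative ring of order $p^3$ with $Z(R)=\{0\}$. Then at least one of the following holds: (i) $\gamma(\Gamma(R))=p^2+p+1$; (ii) $\gamma(\Gamma(R))=\ell_1+\ell_2$, where $\ell_1$ and $\ell_2$ are some non-negative integers satisfying $\ell_1+(p+1)\ell_2=p^2+p+1$.
   Context: Rings are associative and are not required to have a multiplicative identity. $Z(R)$ is the center of $R$. For a non-commutative ring $R$, the commuting graph $\Gamma(R)$ is the simple graph with vertex set $R\setminus Z(R)$ in which two vertices $x,y$ are adjacent if and only if $x\neq y$ and $xy=yx$. A dominating set of a graph $G$ is a subset $D\subseteq V(G)$ such that every vertex not in $D$ is adjacent to at least one vertex of $D$; the domination number $\gamma(G)$ is the minimum cardinality of a dominating set. *)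

(* Defs.v *)
From HB Require Import structures.
From mathcomp Require Import all_boot all_order all_algebra.
Set Implicit Arguments.
Unset Strict Implicit.
Unset Printing Implicit Defensive.

Import GRing.Theory.

(* The ring structures of ssralg all have a multiplicative identity.  Here a
   ring is associative, with no identity assumed. *)
HB.mixin Record Zmodule_isRng R of GRing.Zmodule R := {
  rngmul : R -> R -> R;
  rngmulA : associative rngmul;
  rngmulDl : left_distributive rngmul +%R;
  rngmulDr : right_distributive rngmul +%R
}.

#[short(type="finRngType")]
HB.structure Definition FinRng := { R of Zmodule_isRng R & FinRing.Zmodule R }.

Definition rngcomm (R : finRngType) (x y : R) : bool :=
  rngmul x y == rngmul y x.

Definition noncommutative (R : finRngType) : Prop :=
  exists x y : R, rngmul x y <> rngmul y x.

Definition rngcenter (R : finRngType) : {set R} :=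
  [set x | [forall y : R, rngcomm x y]].

Record sgraph := SGraph {
  vertex :> finType;
  adj : rel vertex;
  adj_sym : symmetric adj;
  adj_irr : irreflexive adj
}.

Section Domination.
Variable G : sgraph.

Definition dominating (D : {set G}) : bool :=
  [forall x : G, (x \notin D) ==> [exists y in D, adj x y]].

Definition domination_number : nat :=
  #|[arg min_(D < [set: G] | dominating D) #|D| ]|%N.

Lemma dominating_setT : dominating [set: G].
Proof. by apply/forallP => x; rewrite in_setT. Qed.

Lemma domination_numberP :
  (exists2 D : {set G}, dominating D & #|D| = domination_number) /\
  (forall D : {set G}, dominating D -> domination_number <= #|D|).
Proof.
rewrite /domination_number; case: arg_minnP => [|D domD minD].
  exact: dominating_setT.
by split; first exists D.
Qed.

End Domination.

Section CommutingGraph.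
Variable R : finRngType.

Definition cg_vertex : finType := {x : R | x \notin rngcenter R}.

Definition cg_adj : rel cg_vertex :=
  fun x y => (x != y) && rngcomm (val x) (val y).

Lemma cg_adj_sym : symmetric cg_adj.
Proof. by move=> x y; rewrite /cg_adj /rngcomm eq_sym [X in _ && X]eq_sym. Qed.

Lemma cg_adj_irr : irreflexive cg_adj.
Proof. by move=> x; rewrite /cg_adj eqxx. Qed.

Definition commuting_graph : sgraph := SGraph cg_adj_sym cg_adj_irr.

End CommutingGraph.

(* Main.v *)
From HB Require Import structures.
Require Import Defs.
From mathcomp Require Import all_boot all_order all_algebra all_fingroup zify.

(** In a ring of order p^3 whose center is zero, the centralizer of a nonzero
    element is a proper nonzero additive subgroup, so it has order p or p^2.
    This forces commutation to be transitive on nonzero elements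
    ([centralizer_sub]): if x and z are nonzero and commute, then the subgroup
    of elements that commute with both contains x and z, and either it has
    order p, and z is an additive multiple of x, or it has order p^2, and it
    is the whole centralizer of x.

    Hence the commuting graph is a disjoint union of cliques, the centralizers
    of nonzero elements with 0 removed, and these have p - 1 or p^2 - 1
    vertices.  A dominating set of a disjoint union of cliques must meet every
    clique, and one vertex in each suffices, so the domination number is the
    number of cliques ([domination_number_cliques]).  If l1 cliques are small
    and l2 are large, counting vertices gives
    l1 * (p - 1) + l2 * (p^2 - 1) = p^3 - 1, and dividing by p - 1 gives
    l1 + (p + 1) * l2 = p^2 + p + 1.  The second alternative of the theorem
    therefore always holds. *)

Set Implicit Arguments.
Unset Strict Implicit.
Unset Printing Implicit Defensive.

Section Cliques.
Variable G : sgraph.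

Definition closed_adj : rel G := fun x y => (x == y) || adj x y.

Lemma dominatingP (D : {set G}) :
  reflect (forall x, exists2 y, y \in D & closed_adj x y) (dominating D).
Proof.
apply: (iffP forallP) => [domD x | domD x].
  case: (boolP (x \in D)) => [Dx | D'x].
    by exists x; rewrite // /closed_adj eqxx.
  have /existsP[y /andP[Dy xy]] := implyP (domD x) D'x.
  by exists y; rewrite /closed_adj ?xy ?orbT.
apply/implyP => D'x; have [y Dy /orP[/eqP xy | xy]] := domD x.
  by rewrite xy Dy in D'x.
by apply/existsP; exists y; rewrite Dy.
Qed.

(** The hypothesis says that G is a disjoint union of cliques.  A transversal
    of the cliques dominates; conversely each clique contains a vertex of any
    dominating set, because the neighbours of a vertex lie in its clique. *)
Lemma domination_number_cliques :
  equivalence_rel closed_adj ->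
  domination_number G = #|equivalence_partition closed_adj [set: G]|.
Proof.
move=> eqG; set P := equivalence_partition _ _.
have eqGT : {in [set: G] & &, equivalence_rel closed_adj} by move=> x y z _ _ _.
have partP : partition P [set: G] := equivalence_partitionP eqGT.
have [/eqP covP tiP _] := and3P partP.
have mem_blockE x y : (y \in pblock P x) = closed_adj x y.
  by rewrite pblock_equivalence_partition ?inE.
have [[D domD oD] minD] := domination_numberP G.
have trP := transversalP partP.
apply/eqP; rewrite eqn_leq -{1}(card_transversal trP) minD /=; last first.
  apply/dominatingP => x.
  have: pblock P x \in P by rewrite pblock_mem ?covP ?inE.
  rewrite -{2}(pblock_transversal trP) => /imsetP[y Ty eq_xy].
  by exists y => //; rewrite -mem_blockE eq_xy mem_pblock covP inE.
rewrite -oD; apply: leq_trans (leq_imset_card (pblock P) D).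
apply/subset_leq_card/subsetP => A; rewrite -{1}(pblock_transversal trP).
case/imsetP=> x _ ->; have [y Dy xy] := dominatingP D domD x.
by apply/imsetP; exists y => //; apply/esym/(same_pblock tiP); rewrite mem_blockE.
Qed.

End Cliques.

Section Centralizers.
Variable R : finRngType.

(** Lagrange's theorem is needed for the additive group of R. *)
HB.instance Definition _ := [finGroupMixin of R for +%R].

Definition rngcentralizer (x : R) : {set R} := [set y | rngcomm x y].

Lemma rngcommC (x y : R) : rngcomm x y = rngcomm y x.
Proof. exact: eq_sym. Qed.

Lemma rngcommxx (x : R) : rngcomm x x.
Proof. exact: eqxx. Qed.

Lemma rngcomm0 (x : R) : rngcomm x 0%R.
Proof.
apply/eqP; transitivity (0%R : R).
  by apply: (GRing.addrI (rngmul x 0%R)); rewrite -rngmulDr !GRing.addr0.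
by apply: (GRing.addrI (rngmul 0%R x)); rewrite -rngmulDl !GRing.addr0.
Qed.

Lemma rngcentralizer_group_set x : group_set (rngcentralizer x).
Proof.
apply/group_setP; split=> [|y z]; first by rewrite inE rngcomm0.
rewrite !inE => /eqP xy /eqP xz.
by apply/eqP; rewrite [(y * z)%g]/(y + z)%R rngmulDr rngmulDl xy xz.
Qed.

Canonical rngcentralizer_group x := Group (rngcentralizer_group_set x).

(** The elements commuting with x and z form a subgroup H of p-power order
    containing both.  If H has order p it is generated by x, so z is a multiple
    of x; otherwise H fills the centralizer of x. *)
Lemma centralizer_sub p (x z : R) :
  prime p -> #|rngcentralizer x| %| p ^ 2 -> x != 0%R -> rngcomm x z ->
  rngcentralizer x \subset rngcentralizer z.
Proof.
move=> p_pr Cx_dvd x_neq0 xz.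
pose H := (rngcentralizer_group x :&: rngcentralizer_group z)%G.
have Hx : x \in H by rewrite !inE rngcommxx rngcommC.
have Hz : z \in H by rewrite !inE rngcommxx xz.
have H_sub : H \subset rngcentralizer x by apply: subsetIl.
have x_neq1 : <[x]>%g != 1%g by rewrite cycle_eq1.
have: #|H| %| p ^ 2 by apply: dvdn_trans Cx_dvd; apply: cardSg.
case/(dvdn_pfactor _ _ p_pr) => m m_le2 oH.
case: m m_le2 oH => [|[|[|//]]] _ oH.
- have /eqP H1 : H :==: 1%g by rewrite trivg_card1 oH.
  by move: Hx; rewrite H1 inE (negPf x_neq0).
- have Hcyc : <[x]>%g = H.
    apply/eqP; rewrite eqEcard cycle_subG Hx oH expn1 /=.
    have: #|<[x]>%g| %| p by rewrite -(expn1 p) -oH cardSg ?cycle_subG.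
    case/primeP: p_pr => _ /[apply] /orP[|/eqP-> //].
    by rewrite -trivg_card1 (negPf x_neq1).
  apply/subsetP => y; rewrite inE rngcommC => yx.
  have: <[x]>%g \subset rngcentralizer_group y by rewrite cycle_subG inE.
  by rewrite inE rngcommC Hcyc => /subsetP/(_ z Hz); rewrite inE.
- have: H :==: rngcentralizer x.
    by rewrite eqEcard H_sub oH dvdn_leq // expn_gt0 prime_gt0.
  by move/eqP<-; apply: subsetIr.
Qed.

Section OrderCube.
Variable p : nat.
Hypotheses (p_pr : prime p) (oR : #|R| = p ^ 3).
Hypothesis (R_center : rngcenter R = [set 0%R]).

(** Orders 1 and p^3 are excluded: the centralizer of x contains both 0 and x,
    and it is all of R only when x is central. *)
Lemma card_centralizer (x : R) :
  x != 0%R -> #|rngcentralizer x| = p \/ #|rngcentralizer x| = p ^ 2.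
Proof.
move=> x_neq0.
have: #|rngcentralizer_group x| %| p ^ 3.
  by rewrite -oR -cardsT (cardSg (G := [set: R]%G)) ?subsetT.
case/(dvdn_pfactor _ _ p_pr) => m m_le3 oC.
case: m m_le3 oC => [|[|[|[|//]]]] _ oC; [ | by left | by right | ].
- have /eqP C1 : rngcentralizer_group x :==: 1%g by rewrite trivg_card1 oC.
  have : x \in rngcentralizer_group x by rewrite inE rngcommxx.
  by rewrite C1 inE (negPf x_neq0).
- have: x \in rngcenter R.
    rewrite inE; apply/forallP => y.
    have: rngcentralizer x == [set: R].
      by rewrite eqEcard subsetT cardsT oR oC /=.
    by move/eqP/setP/(_ y); rewrite !inE.
  by rewrite R_center inE (negPf x_neq0).
Qed.

Lemma vertex_neq0 (x : commuting_graph R) : val x != 0%R.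
Proof. by apply: contraNneq (valP x) => ->; rewrite R_center inE. Qed.

Lemma closed_adjE (x y : commuting_graph R) :
  closed_adj x y = rngcomm (val x) (val y).
Proof.
rewrite /closed_adj /= /cg_adj; case: eqP => [->|] //=.
by rewrite rngcommxx.
Qed.

(** Transitivity: by [centralizer_sub] in both directions, commuting nonzero
    elements have the same centralizer. *)
Lemma commuting_graph_cliques :
  equivalence_rel (@closed_adj (commuting_graph R)).
Proof.
have Csub (x y : commuting_graph R) :
    rngcomm (val x) (val y) ->
    rngcentralizer (val x) \subset rngcentralizer (val y).
  apply: (centralizer_sub p_pr _ (vertex_neq0 x)).
  by case: (card_centralizer (vertex_neq0 x)) => ->;
    rewrite ?dvdnn ?dvdn_exp.
move=> x y z; rewrite !closed_adjE rngcommxx; split=> // xy.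
apply/idP/idP => h.
  by have /subsetP/(_ (val z)) := Csub _ _ xy; rewrite !inE; apply.
rewrite rngcommC in xy.
by have /subsetP/(_ (val z)) := Csub _ _ xy; rewrite !inE; apply.
Qed.

(** The clique of x, seen inside R, is the centralizer of x without 0, because
    every nonzero element is a vertex. *)
Lemma card_clique (x : commuting_graph R) :
  #|[set y in [set: commuting_graph R] | closed_adj x y]| =
  #|rngcentralizer (val x)|.-1.
Proof.
rewrite (cardsD1 0%R (rngcentralizer _)) inE rngcomm0 /=.
rewrite -(card_imset _ val_inj); apply: eq_card => y.
rewrite !inE; apply/imsetP/andP => [[z] | [y_neq0 xy]].
  by rewrite !inE closed_adjE => xz ->; split=> //; apply: vertex_neq0.
have Zy : y \notin rngcenter R by rewrite R_center inE.
by exists (Sub y Zy); rewrite ?SubK ?inE ?closed_adjE ?SubK.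
Qed.

Lemma card_vertices : #|[set: commuting_graph R]| = (p ^ 3).-1.
Proof.
rewrite cardsT card_sig -oR -[#|R|]cardsT (cardsD1 0%R [set: R]) inE /=.
by apply: eq_card => x; rewrite R_center !inE andbT.
Qed.

End OrderCube.
End Centralizers.

(** Both block sizes are multiples of p - 1, with quotients 1 and p + 1, and so
    is p^3 - 1, with quotient p^2 + p + 1; counting D by blocks and cancelling
    p - 1 gives the equation. *)
Lemma two_sizes_partition (T : finType) (P : {set {set T}}) (D : {set T}) p :
  1 < p -> partition P D -> #|D| = (p ^ 3).-1 ->
  {in P, forall A : {set T}, #|A| = p.-1 \/ #|A| = (p ^ 2).-1} ->
  exists l1 l2, l1 + (p + 1) * l2 = p ^ 2 + p + 1 /\ #|P| = l1 + l2.
Proof.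
move=> p_gt1 partP oD oP; pose small (A : {set T}) := #|A| == p.-1.
exists (\sum_(A in P | small A) 1), (\sum_(A in P | ~~ small A) 1); split; last first.
  by rewrite -sum1_card (bigID small).
have p1_gt0 : 0 < p.-1 by lia.
apply/eqP; rewrite -(eqn_pmul2l p1_gt0); apply/eqP.
have -> : p.-1 * (p ^ 2 + p + 1) = #|D| by rewrite oD; nia.
rewrite (card_partition partP) [RHS](bigID small) /= mulnDr !big_distrr /= !muln1.
congr (_ + _).
  by apply: eq_bigr => A /andP[_ /eqP].
apply: eq_bigr => A /andP[/oP[|->]]; first by rewrite /small => ->; rewrite eqxx.
nia.
Qed.

Theorem theoremB (p : nat) (R : finRngType) (p_prime : prime p)
    (R_noncomm : noncommutative R) (R_order : #|R| = p ^ 3)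
    (R_center : rngcenter R = [set 0%R]) :
  domination_number (commuting_graph R) = p ^ 2 + p + 1 \/
  exists l1 l2 : nat,
    l1 + (p + 1) * l2 = p ^ 2 + p + 1 /\
    domination_number (commuting_graph R) = l1 + l2.
Proof.
right.
have eqG := commuting_graph_cliques p_prime R_order R_center.
rewrite (domination_number_cliques eqG).
apply: (two_sizes_partition (prime_gt1 p_prime)).
- by apply: equivalence_partitionP => x y z _ _ _; apply: eqG.
- exact: card_vertices.
move=> A /imsetP[x _ ->]; rewrite card_clique //.
have x_neq0 := vertex_neq0 R_center x.
by case: (card_centralizer p_prime R_order R_center x_neq0) => ->;
  [left | right].
Qed.
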